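(* Let $f(t)=\sum_{k=0}^{\infty}a_k t^k$ be a function analytic in a neighborhood of $0$. Then, for $t$ in a neighborhood of zero where both sides converge, \[ \sum_{n=0}^{\infty}a_nH_n(x)\frac{t^n}{n!}=e^{2xt-t^2}\sum_{n=0}^{\infty}(-1)^nH_n(x-t)\frac{t^n}{n!}\left\{\sum_{k=0}^{n}\binom{n}{k}(-1)^k a_k\right\}. \]
   Context: $H_n(x)$ denote the Hermite polynomials, defined by the generating function $e^{2xt-t^2}=\sum_{n=0}^\infty H_n(x)\frac{t^n}{n!}$ (equivalently $H_n(x)=(-1)^ne^{x^2}\frac{d^n}{dx^n}e^{-x^2}$). *)

(* Defs.v *)
From Stdlib Require Import Reals Factorial.
From Coquelicot Require Import Coquelicot.
Open Scope C_scope.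

(** Here [C] is Coquelicot's type of complex numbers; the binomial coefficient
    of the standard library is written [Binomial.C]. *)

Definition Cexp (z : C) : C :=
  RtoC (exp (Re z)) * (RtoC (cos (Im z)) + Ci * RtoC (sin (Im z))).

(** [f] is analytic near [0], with [sum a_k t^k] as its expansion there. *)
Definition analytic_at_0_with (f : C -> C) (a : nat -> C) : Prop :=
  locally (RtoC 0) (fun t : C => is_series (fun k : nat => a k * t ^ k) (f t)).

(** The generating function of the Hermite polynomials. As power series
    coefficients are unique, it determines every value [H n x]. *)
Definition is_Hermite (H : nat -> C -> C) : Prop :=
  forall x t : C,
    is_series (fun n : nat => H n x * (t ^ n / RtoC (INR (fact n))))
              (Cexp (RtoC 2 * x * t - t ^ 2)).

Definition lhs_term (H : nat -> C -> C) (a : nat -> C) (x t : C) (n : nat) : C :=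
  a n * H n x * (t ^ n / RtoC (INR (fact n))).

Definition binomial_sum (a : nat -> C) (n : nat) : C :=
  sum_n (fun k : nat => RtoC (Binomial.C n k) * (- RtoC 1) ^ k * a k) n.

(** The summand of the series multiplied by [e^(2xt - t^2)] on the right. *)
Definition rhs_term (H : nat -> C -> C) (a : nat -> C) (x t : C) (n : nat) : C :=
  (- RtoC 1) ^ n * H n (x - t) * (t ^ n / RtoC (INR (fact n)))
  * binomial_sum a n.

(* Main.v *)
(** Fix [y] and [s], write [h n = H n y], and let [J k] be the sum over [m] of
    [h (k+m) s^m / m!].  For any geometrically bounded sequence [p], summing the
    triangle [h n / n! * C(n,k) * p k * s^(n-k)] by rows and by columns gives
      sum_k p k / k! * J k = sum_n h n / n! * sum_{k<=n} C(n,k) * p k * s^(n-k);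
    convergence is absolute because the generating function is entire, so that
    [h n / n!] decays faster than any geometric sequence.
    With [p k = u^k] the right side is the generating function at [s + u], and
    comparing coefficients of [u^k] gives [J k = e^(2ys-s^2) H_k(y-s)].
    With [p k = a k t^k], [y = x - t] and [s = -t], the right side is the series
    to be transformed and [J k = e^(-(2xt-t^2)) H_k(x)]; hence the identity holds
    at every complex [t]. *)

Require Import Defs.
From Stdlib Require Import Reals Factorial Lra Lia ClassicalEpsilon.
From Coquelicot Require Import Coquelicot.
Open Scope C_scope.

(* [ring] and [field] do not see through the coercions from Coquelicot's
   algebraic structures to [C]. *)
Ltac C_eq :=
  change plus with Cplus;
  match goal with |- @eq _ ?a ?b => change (@eq C a b) end.

Ltac C_ring :=
  C_eq;
  first [ring | symmetry; ring].

(** * Convergence of complex series *)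

Lemma is_series_C_eps (a : nat -> C) (l : C) :
  is_series a l <->
  (forall eps : posreal,
     exists N : nat, forall n : nat, (N <= n)%nat -> Cmod (sum_n a n - l) < eps).
Proof.
  unfold is_series. split; intros h.
  - intros eps.
    exact (proj1 (@filterlim_locally_ball_norm C_AbsRing nat C_NormedModule
             eventually _ (sum_n a) l) h eps).
  - apply (proj2 (@filterlim_locally_ball_norm C_AbsRing nat C_NormedModule
             eventually _ (sum_n a) l)).
    intros eps. exact (h eps).
Qed.

(** Closed balls are closed: otherwise a late partial sum close to [l] would violate the triangle
    inequality. *)
Lemma Cmod_series_minus_le (a : nat -> C) (l z : C) (B : R) (N : nat) :
  is_series a l ->
  (forall n : nat, (N <= n)%nat -> Cmod (sum_n a n - z) <= B) ->
  Cmod (l - z) <= B.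
Proof.
  intros h hB. apply Rnot_lt_le. intros hlt.
  assert (he : 0 < Cmod (l - z) - B) by lra.
  destruct (proj1 (is_series_C_eps a l) h (mkposreal _ he)) as [N' hN'].
  simpl in hN'.
  specialize (hN' (Nat.max N N') (Nat.le_max_r _ _)).
  specialize (hB (Nat.max N N') (Nat.le_max_l _ _)).
  set (S := sum_n a (Nat.max N N')) in *.
  assert (ht := Cmod_triangle (l - S) (S - z)).
  replace (l - S + (S - z)) with (l - z) in ht by C_ring.
  replace (l - S) with (- (S - l)) in ht by C_ring.
  rewrite Cmod_opp in ht. lra.
Qed.

Lemma is_series_C_unique (a : nat -> C) (l l' : C) :
  is_series a l -> is_series a l' -> l = l'.
Proof.
  exact (@filterlim_locally_unique nat C_AbsRing C_NormedModule eventually _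
           (sum_n a) l l').
Qed.

Lemma is_series_C_ext (a b : nat -> C) (l : C) :
  (forall n : nat, a n = b n) -> is_series a l -> is_series b l.
Proof. exact (@is_series_ext C_AbsRing C_NormedModule a b l). Qed.

Lemma is_series_Cmult (c : C) (a : nat -> C) (l : C) :
  is_series a l -> is_series (fun n : nat => c * a n) (c * l).
Proof. exact (@is_series_scal C_AbsRing C_NormedModule c a l). Qed.

Lemma is_series_C_minus (a b : nat -> C) (la lb : C) :
  is_series a la -> is_series b lb ->
  is_series (fun n : nat => a n - b n) (la - lb).
Proof. exact (@is_series_minus C_AbsRing C_NormedModule a b la lb). Qed.

Lemma is_series_C_sum (E : nat -> nat -> C) (r : nat -> C) (N : nat) :
  (forall k : nat, is_series (E k) (r k)) ->
  is_series (fun n : nat => sum_n (fun k : nat => E k n) N) (sum_n r N).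
Proof.
  intros h. induction N as [|N IH].
  - rewrite sum_O. apply (is_series_C_ext (E 0%nat)); [|apply h].
    intros n. now rewrite sum_O.
  - rewrite sum_Sn.
    apply (is_series_C_ext
      (fun n => plus (sum_n (fun k => E k n) N) (E (S N) n))).
    + intros n. now rewrite sum_Sn.
    + exact (@is_series_plus C_AbsRing C_NormedModule _ _ _ _ IH (h (S N))).
Qed.

(** Serves to sum a row of a triangular array, whose entries vanish before the diagonal. *)
Lemma is_series_C_drop_zeros (k : nat) (a : nat -> C) (l : C) :
  (forall n : nat, (n < k)%nat -> a n = 0) ->
  is_series (fun m : nat => a (k + m)%nat) l -> is_series a l.
Proof.
  revert a. induction k as [|k IH]; intros a ha h; [exact h|].
  assert (hd := @is_series_decr_1 C_AbsRing C_NormedModule a l).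
  change (plus l (opp (a 0%nat))) with (l + - a 0%nat) in hd.
  rewrite (ha 0%nat) in hd by lia.
  replace (l + - RtoC 0) with l in hd by C_ring.
  apply hd, IH; [|exact h].
  intros n hn. apply ha. lia.
Qed.

(** * Finite sums and interchange of summations *)

Lemma Cmod_sum_n_m_le (a : nat -> C) (n m : nat) :
  Cmod (sum_n_m a n m) <= sum_n_m (fun k : nat => Cmod (a k)) n m.
Proof. exact (@norm_sum_n_m C_AbsRing C_NormedModule a n m). Qed.

Lemma sum_n_split (a : nat -> C) (n m : nat) :
  (n <= m)%nat -> sum_n a m = sum_n a n + sum_n_m a (S n) m.
Proof.
  intros h. unfold sum_n.
  exact (@sum_n_m_Chasles C_AbelianMonoid a 0%nat n m (Nat.le_0_l _) h).
Qed.

Lemma sum_n_Cmult (c : C) (a : nat -> C) (n : nat) :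
  sum_n (fun k : nat => c * a k) n = c * sum_n a n.
Proof. exact (@sum_n_mult_l C_Ring c a n). Qed.

Lemma sum_n_m_nonneg (b : nat -> R) (n m : nat) :
  (forall k : nat, 0 <= b k) -> 0 <= sum_n_m b n m.
Proof.
  intros hb.
  replace 0%R with (@sum_n_m R_AbelianMonoid (fun _ => 0%R) n m).
  - now apply sum_n_m_le.
  - exact (@sum_n_m_const_zero R_AbelianMonoid n m).
Qed.

Lemma sum_n_m_tail_le_sum_n (b : nat -> R) (n m : nat) :
  (forall k, 0 <= b k)%R -> (n <= m)%nat ->
  sum_n_m b (S n) m <= sum_n b m.
Proof.
  intros hb h. unfold sum_n.
  rewrite (@sum_n_m_Chasles R_AbelianMonoid b 0%nat n m (Nat.le_0_l _) h).
  change plus with Rplus.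
  assert (h0 := sum_n_m_nonneg b 0 n hb). lra.
Qed.

Lemma term_le_sum_n (b : nat -> R) (k n : nat) :
  (forall j : nat, 0 <= b j) -> (k <= n)%nat -> b k <= sum_n b n.
Proof.
  intros hb h. apply Rle_trans with (sum_n b k).
  - destruct k as [|k]; [rewrite sum_O; apply Rle_refl|].
    assert (h0 := sum_n_m_nonneg b 0 k hb).
    change (0 <= sum_n b k) in h0.
    rewrite sum_Sn. change plus with Rplus. lra.
  - unfold sum_n.
    rewrite (@sum_n_m_Chasles R_AbelianMonoid b 0%nat k n (Nat.le_0_l _) h).
    assert (h0 := sum_n_m_nonneg b (S k) n hb). change plus with Rplus. lra.
Qed.

(** A Fubini theorem for triangular arrays: the order of summation may be exchanged because the
    absolute sums at fixed [n] have the summable majorant [T]. *)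
Lemma is_series_rows_of_triangle (E : nat -> nat -> C) (r : nat -> C) (T : nat -> R) (l : C) :
  (forall k n : nat, (n < k)%nat -> E k n = 0) ->
  (forall k : nat, is_series (E k) (r k)) ->
  (forall n : nat, sum_n (fun k : nat => Cmod (E k n)) n <= T n) ->
  ex_series T ->
  is_series (fun n : nat => sum_n (fun k : nat => E k n) n) l ->
  is_series r l.
Proof.
  intros hE hr hT exT hl.
  apply is_series_C_eps. intros eps.
  (* [l] minus the first [N] row sums is a series [d] whose terms vanish up to
     index [N] and are dominated by [T]: a tail of [T] bounds it. *)
  destruct (Cauchy_ex_series T exT (pos_div_2 eps)) as [N0 hN0].
  exists N0. intros N hN.
  set (d := fun n => sum_n (fun k => E k n) n - sum_n (fun k => E k n) N).
  assert (hd : is_series d (l - sum_n r N)).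
  { apply is_series_C_minus; [exact hl|]. now apply is_series_C_sum. }
  assert (hd0 : forall n, (n <= N)%nat -> d n = 0).
  { intros n hn. unfold d.
    rewrite (sum_n_split (fun k => E k n) n N hn).
    rewrite (sum_n_m_ext_loc _ (fun _ => zero)).
    2: { intros k hk. apply hE. lia. }
    rewrite sum_n_m_const_zero. change zero with (RtoC 0). C_ring. }
  assert (hdT : forall n, Cmod (d n) <= T n).
  { intros n. destruct (Nat.le_gt_cases n N) as [hn|hn].
    - rewrite (hd0 n hn), Cmod_0. eapply Rle_trans; [|apply hT].
      apply sum_n_m_nonneg. intros k. apply Cmod_ge_0.
    - unfold d. rewrite (sum_n_split (fun k => E k n) N n) by lia.
      replace (sum_n (fun k => E k n) N + sum_n_m (fun k => E k n) (S N) n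
               - sum_n (fun k => E k n) N)
        with (sum_n_m (fun k => E k n) (S N) n) by C_ring.
      eapply Rle_trans; [apply Cmod_sum_n_m_le|].
      eapply Rle_trans; [|apply hT].
      apply sum_n_m_tail_le_sum_n; [|lia]. intros k. apply Cmod_ge_0. }
  replace (sum_n r N - l) with (- (l - sum_n r N - 0)) by C_ring.
  rewrite Cmod_opp.
  (* Passing to the limit keeps only a non-strict bound, so the tail was taken below [eps / 2]. *)
  apply Rle_lt_trans with (pos_div_2 eps); [|simpl; destruct eps; simpl; lra].
  apply (Cmod_series_minus_le d _ 0 _ (S N) hd).
  intros P hP.
  rewrite (sum_n_split d N P) by lia.
  replace (sum_n d N) with (RtoC 0).
  2: { symmetry. unfold sum_n. rewrite (sum_n_m_ext_loc _ (fun _ => zero)).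
       - exact (@sum_n_m_const_zero C_AbelianMonoid 0 N).
       - intros n hn. apply hd0. lia. }
  replace (RtoC 0 + sum_n_m d (S N) P - 0) with (sum_n_m d (S N) P) by C_ring.
  eapply Rle_trans; [apply Cmod_sum_n_m_le|].
  eapply Rle_trans; [apply (sum_n_m_le _ T); exact hdT|].
  eapply Rle_trans; [apply Rle_abs|].
  apply Rlt_le. apply (hN0 (S N) P); lia.
Qed.

(** * Binomial coefficients and the complex binomial theorem *)

Lemma Binomial_C_nonneg (n k : nat) : 0 <= Binomial.C n k.
Proof.
  unfold Binomial.C. apply Rlt_le, Rdiv_lt_0_compat.
  - apply INR_fact_lt_0.
  - apply Rmult_lt_0_compat; apply INR_fact_lt_0.
Qed.

Lemma Binomial_C_n_0 (n : nat) : Binomial.C n 0 = 1%R.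
Proof.
  unfold Binomial.C. rewrite Nat.sub_0_r. simpl. field. apply INR_fact_neq_0.
Qed.

Lemma Binomial_C_n_n (n : nat) : Binomial.C n n = 1%R.
Proof.
  unfold Binomial.C. rewrite Nat.sub_diag. simpl. field. apply INR_fact_neq_0.
Qed.

Lemma RtoC_fact_neq_0 (n : nat) : RtoC (INR (fact n)) <> 0.
Proof. intros h. apply RtoC_inj in h. now apply INR_fact_neq_0 in h. Qed.

Lemma C_binomial (u s : C) (n : nat) :
  sum_n (fun k : nat => RtoC (Binomial.C n k) * u ^ k * s ^ (n - k)) n
  = (s + u) ^ n.
Proof.
  (* Pascal's rule, telescoped over partial sums. *)
  assert (hpart : forall n N : nat, (N <= n)%nat ->
    sum_n (fun k => RtoC (Binomial.C (S n) k) * u ^ k * s ^ (S n - k)) N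
    + RtoC (Binomial.C n N) * u ^ S N * s ^ (n - N)
    = (s + u) * sum_n (fun k => RtoC (Binomial.C n k) * u ^ k * s ^ (n - k)) N).
  { clear n. intros n N. induction N as [|N IH]; intros hN.
    - rewrite !sum_O, !Binomial_C_n_0, !Nat.sub_0_r, !Cpow_S. simpl. ring.
    - rewrite !sum_Sn. change plus with Cplus.
      rewrite Cmult_plus_distr_l, <- IH by lia.
      rewrite <- pascal by lia.
      replace (S n - S N)%nat with (S (n - S N)) by lia.
      replace (n - N)%nat with (S (n - S N)) by lia.
      rewrite RtoC_plus, !Cpow_S.
      C_ring. }
  induction n as [|n IH].
  - rewrite sum_O, Binomial_C_n_0. simpl. ring.
  (* At [N = n] the boundary term of [hpart] is [u ^ S n], the last summand for exponent [S n]. *)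
  - rewrite Cpow_S, <- IH, <- (hpart n n) by lia.
    rewrite sum_Sn, !Binomial_C_n_n, !Nat.sub_diag. C_ring.
Qed.

(** * Uniqueness of power series coefficients *)

Lemma series_terms_bounded (a : nat -> C) (l : C) :
  is_series a l -> exists K : R, forall n : nat, Cmod (a n) <= K.
Proof.
  intros h.
  destruct (@filterlim_bounded C_AbsRing C_NormedModule (sum_n a)
              (ex_intro _ l h)) as [M hM].
  change (forall n, Cmod (sum_n a n) <= M) in hM.
  exists (M + M)%R. intros n. destruct n as [|n].
  - specialize (hM 0%nat). rewrite sum_O in hM.
    assert (h0 := Cmod_ge_0 (a 0%nat)). lra.
  - assert (h1 := hM n). assert (h2 := hM (S n)). rewrite sum_Sn in h2.
    change plus with Cplus in h2.
    replace (a (S n)) with (sum_n a n + a (S n) + - sum_n a n) by C_ring.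
    eapply Rle_trans; [apply Cmod_triangle|]. rewrite Cmod_opp. lra.
Qed.

(** Away from the constant term the series is O([u]) as [u] tends to 0, so a zero sum forces [c 0]
    to vanish. Restricting to [u <> 0] lets the later induction divide by [u]. *)
Lemma power_series_zero_coef0 (c : nat -> C) :
  (forall u : C, u <> 0 -> is_series (fun k : nat => c k * u ^ k) (RtoC 0)) ->
  c 0%nat = 0.
Proof.
  intros h.
  assert (h2 : RtoC 2 <> 0) by (intros hz; apply RtoC_inj in hz; lra).
  (* Convergence at 2 makes the coefficients decay like [(/ 2) ^ k], which controls the series on
     the unit disc. *)
  destruct (series_terms_bounded _ _ (h (RtoC 2) h2)) as [K hK].
  assert (hc : forall k, (Cmod (c k) <= K * (/ 2) ^ k)%R).
  { intros k. specialize (hK k). rewrite Cmod_mult, Cmod_pow, Cmod_R in hK.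
    rewrite Rabs_pos_eq in hK by lra.
    assert (hp : (0 < 2 ^ k)%R) by (apply pow_lt; lra).
    rewrite pow_inv. apply Rmult_le_reg_r with (2 ^ k)%R; [exact hp|].
    rewrite Rmult_assoc, Rinv_l by lra. lra. }
  assert (hK0 : 0 <= K) by (assert (h0 := Cmod_ge_0 (c 0%nat)); assert (h1 := hc 0%nat); simpl in h1; lra).
  assert (hle : forall e : R, 0 < e <= 1 -> (Cmod (c 0%nat) <= e * K)%R).
  { intros e he.
    assert (he0 : RtoC e <> 0) by (intros hz; apply RtoC_inj in hz; lra).
    replace (c 0%nat) with (- (0 - c 0%nat)) by C_ring. rewrite Cmod_opp.
    apply (Cmod_series_minus_le _ _ _ _ 0%nat (h _ he0)).
    intros n _.
    (* Since [e <= 1], each term of index at least 1 is at most [e * K * (/ 2) ^ k]; the factor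
       [1 - (/ 2) ^ n] is the finite geometric sum, which makes the induction close. *)
    apply Rle_trans with (e * K * (1 - (/ 2) ^ n))%R.
    - induction n as [|n IH].
      + rewrite sum_O. simpl.
        replace (c 0%nat * 1 - c 0%nat) with (RtoC 0) by C_ring.
        rewrite Cmod_0. lra.
      + rewrite sum_Sn. change plus with Cplus.
        match goal with |- context [Cmod (?S + ?a - ?c0)] =>
          replace (S + a - c0) with ((S - c0) + a) by C_ring end.
        eapply Rle_trans; [apply Cmod_triangle|].
        rewrite Cmod_mult, Cmod_pow, Cmod_R, Rabs_pos_eq by lra.
        assert (hen : (0 <= e ^ n <= 1)%R).
        { split; [apply pow_le; lra|]. rewrite <- (pow1 n). apply pow_incr; lra. }
        assert (hcn := hc (S n)). simpl in hcn |- *.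
        assert (hp : (0 < (/ 2) ^ n)%R) by (apply pow_lt; lra).
        assert (Cmod (c (S n)) * (e * e ^ n) <= K * (/ 2 * (/ 2) ^ n) * (e * 1))%R.
        { apply Rmult_le_compat; [apply Cmod_ge_0| |exact hcn|].
          - apply Rmult_le_pos; lra.
          - apply Rmult_le_compat_l; lra. }
        nra.
    - assert (hp : (0 < (/ 2) ^ n)%R) by (apply pow_lt; lra).
      assert (0 <= e * K)%R by nra. nra. }
  apply Cmod_eq_0. apply Rle_antisym; [|apply Cmod_ge_0].
  apply Rnot_lt_le. intros hpos.
  set (m := Cmod (c 0%nat)) in *.
  assert (h1 := hle 1%R ltac:(lra)).
  assert (hKp : 0 < K) by lra.
  (* Taking [e = m / (2 * K)] in [hle] gives [m <= m / 2]; the case [e = 1] has shown [m <= K], so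
     this [e] is admissible. *)
  assert (hq : (0 < m / (2 * K) <= 1)%R).
  { split; [apply Rdiv_lt_0_compat; lra|].
    apply Rmult_le_reg_r with (2 * K)%R; [lra|].
    unfold Rdiv. rewrite Rmult_assoc, Rinv_l by lra. lra. }
  assert (h3 := hle _ hq).
  replace (m / (2 * K) * K)%R with (m / 2)%R in h3 by (field; lra). lra.
Qed.

(** Once the constant term is known to vanish, dividing by [u] leaves a zero series with shifted
    coefficients. *)
Lemma power_series_zero_coef (c : nat -> C) :
  (forall u : C, u <> 0 -> is_series (fun k : nat => c k * u ^ k) (RtoC 0)) ->
  forall k : nat, c k = 0.
Proof.
  intros h k. revert c h. induction k as [|k IH]; intros c h.
  - now apply power_series_zero_coef0.
  - apply (IH (fun k => c (S k))). intros u hu.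
    assert (h0 := power_series_zero_coef0 c h).
    assert (hs := @is_series_incr_1 C_AbsRing C_NormedModule
                    (fun k => c k * u ^ k) (RtoC 0)).
    assert (h1 : is_series (fun k => c (S k) * u ^ S k) (RtoC 0)).
    { apply hs. cbv beta.
      change (is_series (fun k => c k * u ^ k) (RtoC 0 + c 0%nat * u ^ 0)).
      rewrite h0.
      replace (RtoC 0 + 0 * u ^ 0) with (RtoC 0) by ring. now apply h. }
    apply (is_series_Cmult (/ u)) in h1.
    rewrite Cmult_0_r in h1.
    refine (is_series_C_ext _ _ _ _ h1). intros n. rewrite Cpow_S. now field.
Qed.

(** * Geometric majorants for the triangle *)

(** The terms of the convergent series at [t = rho] are bounded. As [rho] is arbitrary, this is
    decay faster than any geometric sequence. *)
Lemma entire_coef_bound (h : nat -> C) (G : C -> C) :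
  (forall t : C, is_series (fun n : nat => h n * (t ^ n / RtoC (INR (fact n)))) (G t)) ->
  forall rho : R, 0 < rho ->
  exists K : R, forall n : nat,
    (Cmod (h n / RtoC (INR (fact n))) * rho ^ n <= K)%R.
Proof.
  intros hG rho hrho.
  destruct (series_terms_bounded _ _ (hG (RtoC rho))) as [K hK].
  exists K. intros n. specialize (hK n).
  replace (h n * (RtoC rho ^ n / RtoC (INR (fact n))))
    with (h n / RtoC (INR (fact n)) * RtoC rho ^ n) in hK
    by (field; apply RtoC_fact_neq_0).
  rewrite Cmod_mult, Cmod_pow, Cmod_R, Rabs_pos_eq in hK by lra.
  exact hK.
Qed.

(** Termwise comparison with the real binomial expansion of [(rho + Cmod s) ^ n]. *)
Lemma appell_term_bound (p : nat -> C) (M rho : R) (s : C) (n : nat) :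
  (forall k : nat, (Cmod (p k) <= M * rho ^ k)%R) ->
  (sum_n (fun k : nat => Cmod (RtoC (Binomial.C n k) * p k * s ^ (n - k))) n
   <= M * (rho + Cmod s) ^ n)%R.
Proof.
  intros hp.
  rewrite binomial, <- sum_n_Reals, <- (@sum_n_mult_l R_Ring).
  apply sum_n_m_le. intros k.
  rewrite !Cmod_mult, Cmod_pow, Cmod_R, Rabs_pos_eq by apply Binomial_C_nonneg.
  change mult with Rmult.
  replace (M * (Binomial.C n k * rho ^ k * Cmod s ^ (n - k)))%R
    with (Binomial.C n k * (M * rho ^ k) * Cmod s ^ (n - k))%R by ring.
  apply Rmult_le_compat_r; [apply pow_le, Cmod_ge_0|].
  apply Rmult_le_compat_l; [apply Binomial_C_nonneg|apply hp].
Qed.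

Lemma ex_series_half_pow (c : R) : ex_series (fun n : nat => (c * (/ 2) ^ n)%R).
Proof.
  apply (@ex_series_scal R_AbsRing R_NormedModule).
  apply ex_series_geom. rewrite Rabs_pos_eq; lra.
Qed.

Lemma appell_geometric_bound (h p : nat -> C) (G : C -> C) (M rho : R) (s : C) :
  (forall t : C, is_series (fun n : nat => h n * (t ^ n / RtoC (INR (fact n)))) (G t)) ->
  0 <= rho ->
  (forall k : nat, (Cmod (p k) <= M * rho ^ k)%R) ->
  exists K : R, forall n : nat,
    (sum_n (fun k : nat => Cmod (h n / RtoC (INR (fact n)) *
        (RtoC (Binomial.C n k) * p k * s ^ (n - k)))) n <= K * (/ 2) ^ n)%R.
Proof.
  intros hG hrho hp.
  assert (hs := Cmod_ge_0 s).
  assert (hM : 0 <= M).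
  { assert (h0 := hp 0%nat). assert (h1 := Cmod_ge_0 (p 0%nat)). simpl in h0. lra. }
  (* The factor 2 produces the decay [(/ 2) ^ n]; the summand 1 keeps [sigma] positive when [rho]
     and [s] both vanish. *)
  set (sigma := (2 * (rho + Cmod s + 1))%R).
  assert (hsigma : 0 < sigma) by (unfold sigma; lra).
  destruct (entire_coef_bound h G hG sigma hsigma) as [K hK].
  exists (K * M)%R. intros n. specialize (hK n).
  set (hn := h n / RtoC (INR (fact n))) in *.
  rewrite (sum_n_ext _ (fun k => mult (Cmod hn)
    (Cmod (RtoC (Binomial.C n k) * p k * s ^ (n - k))))).
  2: { intros k. now rewrite Cmod_mult. }
  rewrite (@sum_n_mult_l R_Ring). change mult with Rmult.
  eapply Rle_trans.
  { apply Rmult_le_compat_l; [apply Cmod_ge_0|]. now apply appell_term_bound. }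
  assert (hpow : ((rho + Cmod s) ^ n <= sigma ^ n * (/ 2) ^ n)%R).
  { rewrite <- Rpow_mult_distr. apply pow_incr. unfold sigma. lra. }
  assert (h2 : (0 < (/ 2) ^ n)%R) by (apply pow_lt; lra).
  apply Rle_trans with (Cmod hn * (M * (sigma ^ n * (/ 2) ^ n)))%R.
  - apply Rmult_le_compat_l; [apply Cmod_ge_0|]. now apply Rmult_le_compat_l.
  - replace (Cmod hn * (M * (sigma ^ n * (/ 2) ^ n)))%R
      with (Cmod hn * sigma ^ n * (M * (/ 2) ^ n))%R by ring.
    rewrite (Rmult_assoc K). apply Rmult_le_compat_r; [|exact hK].
    apply Rmult_le_pos; lra.
Qed.

(** * Summing the triangle in both orders *)

(** The inner sum is the Appell polynomial in [s] attached to [p], with exponential generating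
    function [e^(s*u) * sum_k p k * u^k / k!]. *)
Definition appell_term (h p : nat -> C) (s : C) (n : nat) : C :=
  h n / RtoC (INR (fact n)) *
  sum_n (fun k : nat => RtoC (Binomial.C n k) * p k * s ^ (n - k)) n.

(** Up to the factor [k!], the terms are the entries of the triangle with [p = 1] at [n = k + m], so
    the majorant found above applies. *)
Lemma ex_series_shift (h : nat -> C) (G : C -> C) (s : C) (k : nat) :
  (forall t : C, is_series (fun n : nat => h n * (t ^ n / RtoC (INR (fact n)))) (G t)) ->
  ex_series (fun m : nat => h (k + m)%nat * (s ^ m / RtoC (INR (fact m)))).
Proof.
  intros hG.
  destruct (appell_geometric_bound h (fun _ => RtoC 1) G 1 1 s hG) as [K hK];
    [lra| |].
  { intros j. rewrite pow1, Cmod_1. lra. }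
  apply (@ex_series_le C_AbsRing C_CompleteNormedModule _
           (fun m => (INR (fact k) * (K * (/ 2) ^ (k + m)))%R)).
  - intros m.
    change (Cmod (h (k + m)%nat * (s ^ m / RtoC (INR (fact m))))
            <= INR (fact k) * (K * (/ 2) ^ (k + m)))%R.
    assert (hf := INR_fact_lt_0 k).
    replace (h (k + m)%nat * (s ^ m / RtoC (INR (fact m))))
      with (RtoC (INR (fact k)) * (h (k + m)%nat / RtoC (INR (fact (k + m))) *
        (RtoC (Binomial.C (k + m) k) * RtoC 1 * s ^ (k + m - k)))).
    2: { unfold Binomial.C. replace (k + m - k)%nat with m by lia.
         rewrite RtoC_div, RtoC_mult.
         2: { apply Rmult_integral_contrapositive; split; apply INR_fact_neq_0. }
         field. repeat split; apply RtoC_fact_neq_0. }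
    rewrite Cmod_mult, Cmod_R, Rabs_pos_eq by lra.
    apply Rmult_le_compat_l; [lra|].
    eapply Rle_trans; [|apply hK].
    set (E := fun j => Cmod (h (k + m)%nat / RtoC (INR (fact (k + m))) *
        (RtoC (Binomial.C (k + m) j) * RtoC 1 * s ^ (k + m - j)))).
    change (E k <= sum_n E (k + m)%nat).
    apply term_le_sum_n; [|lia]. intros j. apply Cmod_ge_0.
  - apply (@ex_series_scal R_AbsRing R_NormedModule).
    apply (@ex_series_incr_n R_AbsRing R_NormedModule (fun n => (K * (/ 2) ^ n)%R) k).
    apply ex_series_half_pow.
Qed.

(** At fixed [k], put [n = k + m]: since [C(k+m,k) / (k+m)! = 1 / (k! * m!)], the row sums to
    [p k / k! * J k]. At fixed [n] the sum is [appell_term h p s n]. *)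
Lemma appell_series (h p J : nat -> C) (G : C -> C) (M rho : R) (s : C) :
  (forall t : C, is_series (fun n : nat => h n * (t ^ n / RtoC (INR (fact n)))) (G t)) ->
  0 <= rho ->
  (forall k : nat, (Cmod (p k) <= M * rho ^ k)%R) ->
  (forall k : nat,
    is_series (fun m : nat => h (k + m)%nat * (s ^ m / RtoC (INR (fact m)))) (J k)) ->
  exists l : C,
    is_series (appell_term h p s) l /\
    is_series (fun k : nat => p k / RtoC (INR (fact k)) * J k) l.
Proof.
  intros hG hrho hp hJ.
  destruct (appell_geometric_bound h p G M rho s hG hrho hp) as [K hK].
  (* The explicit zero matters for [n < k], where truncated subtraction would leave a nonzero
     [Binomial.C n k]. *)
  set (E := fun k n : nat => if (k <=? n)%nat then
    h n / RtoC (INR (fact n)) * (RtoC (Binomial.C n k) * p k * s ^ (n - k)) else 0).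
  assert (hE : forall k n, (k <= n)%nat -> E k n =
    h n / RtoC (INR (fact n)) * (RtoC (Binomial.C n k) * p k * s ^ (n - k))).
  { intros k n hkn. unfold E. now rewrite (proj2 (Nat.leb_le k n) hkn). }
  assert (hE0 : forall k n, (n < k)%nat -> E k n = 0).
  { intros k n hkn. unfold E. now rewrite (proj2 (Nat.leb_gt k n) hkn). }
  assert (hsum : forall n, sum_n (fun k => E k n) n = appell_term h p s n).
  { intros n. unfold appell_term. rewrite <- sum_n_Cmult.
    apply sum_n_ext_loc. intros k hk. now apply hE. }
  assert (hT : forall n, (sum_n (fun k => Cmod (E k n)) n <= K * (/ 2) ^ n)%R).
  { intros n. eapply Rle_trans; [|apply hK].
    right. apply sum_n_ext_loc. intros k hk. now rewrite hE. }
  assert (exl : ex_series (appell_term h p s)).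
  { apply (@ex_series_le C_AbsRing C_CompleteNormedModule _
             (fun n => (K * (/ 2) ^ n)%R)); [|apply ex_series_half_pow].
    intros n. change (Cmod (appell_term h p s n) <= K * (/ 2) ^ n)%R.
    rewrite <- hsum. eapply Rle_trans; [apply Cmod_sum_n_m_le|apply hT]. }
  destruct exl as [l hl]. exists l. split; [exact hl|].
  apply (is_series_rows_of_triangle E _ (fun n => (K * (/ 2) ^ n)%R) l hE0).
  - intros k. apply (is_series_C_drop_zeros k); [intros n; apply hE0|].
    refine (is_series_C_ext _ _ _ _
      (is_series_Cmult (p k / RtoC (INR (fact k))) _ _ (hJ k))).
    intros m. rewrite hE by lia. unfold Binomial.C.
    replace (k + m - k)%nat with m by lia.
    rewrite RtoC_div, RtoC_mult.
    2: { apply Rmult_integral_contrapositive; split; apply INR_fact_neq_0. }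
    field. repeat split; apply RtoC_fact_neq_0.
  - exact hT.
  - apply ex_series_half_pow.
  - exact (is_series_C_ext _ _ _ (fun n => eq_sym (hsum n)) hl).
Qed.

(** * The complex exponential and the Hermite shift formula *)

Lemma Cexp_plus (z w : C) : Cexp (z + w) = Cexp z * Cexp w.
Proof.
  destruct z as [a b], w as [c d]. unfold Cexp. simpl.
  rewrite exp_plus, cos_plus, sin_plus.
  apply injective_projections; simpl; ring.
Qed.

Lemma Cexp_0 : Cexp 0 = 1.
Proof.
  unfold Cexp. simpl. rewrite exp_0, cos_0, sin_0.
  apply injective_projections; simpl; ring.
Qed.

(** Formally this is the [k]-th derivative in [s] of the generating function; the proof compares two
    expansions in [u] of its value at [s + u]. *)
Lemma Hermite_shift (H : nat -> C -> C) (y s : C) (k : nat) :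
  is_Hermite H ->
  is_series (fun m : nat => H (k + m)%nat y * (s ^ m / RtoC (INR (fact m))))
    (Cexp (RtoC 2 * y * s - s ^ 2) * H k (y - s)).
Proof.
  intros hH.
  set (h := fun n => H n y).
  set (g := Cexp (RtoC 2 * y * s - s ^ 2)).
  assert (hex := fun j => ex_series_shift h _ s j (hH y)).
  (* All the sums, not yet identified, are chosen at once so that they can serve as power series
     coefficients. *)
  set (J := (fun j => proj1_sig (constructive_indefinite_description _ (hex j))) : nat -> C).
  assert (hJ : forall j, is_series
    (fun m => h (j + m)%nat * (s ^ m / RtoC (INR (fact m)))) (J j)).
  { intros j. exact (proj2_sig (constructive_indefinite_description _ (hex j))). }
  replace (g * H k (y - s)) with (J k); [exact (hJ k)|].
  assert (hc := power_series_zero_coef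
    (fun j => (J j - g * H j (y - s)) / RtoC (INR (fact j)))).
  cbv beta in hc.
  assert (h0 : (J k - g * H k (y - s)) / RtoC (INR (fact k)) = 0).
  { apply hc. clear hc. intros u _.
    destruct (appell_series h (fun j => u ^ j) J _ 1 (Cmod u) s (hH y)
                (Cmod_ge_0 u)) as [l [hl hr]]; [|exact hJ|].
    { intros j. rewrite Cmod_pow. lra. }
    (* The generating function at [s + u] factors into [g] and the generating function at [u] with
       argument [y - s]. *)
    assert (hsum : l = g * Cexp (RtoC 2 * (y - s) * u - u ^ 2)).
    { unfold g. rewrite <- Cexp_plus.
      replace (RtoC 2 * y * s - s ^ 2 + (RtoC 2 * (y - s) * u - u ^ 2))
        with (RtoC 2 * y * (s + u) - (s + u) ^ 2) by ring.
      refine (is_series_C_unique _ _ _ _ (hH y (s + u))).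
      refine (is_series_C_ext _ _ _ _ hl).
      intros n. unfold appell_term. rewrite C_binomial. unfold h.
      field. apply RtoC_fact_neq_0. }
    assert (hd := is_series_C_minus _ _ _ _ hr (is_series_Cmult g _ _ (hH (y - s) u))).
    rewrite <- hsum in hd.
    replace (l - l) with (RtoC 0) in hd by ring.
    refine (is_series_C_ext _ _ _ _ hd).
    intros n.
    C_eq. field. apply RtoC_fact_neq_0. }
  assert (hd : J k - g * H k (y - s) = 0).
  { replace (J k - g * H k (y - s))
      with ((J k - g * H k (y - s)) / RtoC (INR (fact k)) * RtoC (INR (fact k)))
      by (field; apply RtoC_fact_neq_0).
    rewrite h0. ring. }
  replace (J k) with (J k - g * H k (y - s) + g * H k (y - s)) by ring.
  rewrite hd. ring.
Qed.

(** * The series transformation *)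

(** Convergence at the single point [eps / 2] bounds the terms there, whence [rho = / (eps / 2)]. *)
Lemma analytic_coef_bound (f : C -> C) (a : nat -> C) :
  analytic_at_0_with f a ->
  exists M rho : R, 0 <= rho /\ forall k : nat, (Cmod (a k) <= M * rho ^ k)%R.
Proof.
  intros hf.
  destruct (@locally_norm_le_locally C_AbsRing C_NormedModule _ _ hf) as [eps heps].
  assert (he := cond_pos eps).
  assert (hs : is_series (fun k => a k * RtoC (eps / 2) ^ k) (f (RtoC (eps / 2)))).
  { apply heps. change (Cmod (RtoC (eps / 2) - RtoC 0) < eps).
    replace (RtoC (eps / 2) - RtoC 0) with (RtoC (eps / 2)) by ring.
    rewrite Cmod_R, Rabs_pos_eq; lra. }
  destruct (series_terms_bounded _ _ hs) as [K hK].
  exists K, (/ (eps / 2))%R. split; [apply Rlt_le, Rinv_0_lt_compat; lra|].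
  intros k. specialize (hK k).
  rewrite Cmod_mult, Cmod_pow, Cmod_R, Rabs_pos_eq in hK by lra.
  assert (hp : (0 < (eps / 2) ^ k)%R) by (apply pow_lt; lra).
  rewrite pow_inv. apply Rmult_le_reg_r with ((eps / 2) ^ k)%R; [exact hp|].
  rewrite Rmult_assoc, Rinv_l by lra. lra.
Qed.

Lemma neg_one_pow_sqr (k : nat) : (- RtoC 1) ^ k * (- RtoC 1) ^ k = 1.
Proof.
  rewrite <- Cpow_mult_l. replace (- RtoC 1 * - RtoC 1) with (RtoC 1) by ring.
  apply Cpow_1_l.
Qed.

Lemma Hermite_series_transform (H : nat -> C -> C) (f : C -> C) (a : nat -> C) (x t : C) :
  is_Hermite H -> analytic_at_0_with f a ->
  exists r : C,
    is_series (rhs_term H a x t) r /\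
    is_series (lhs_term H a x t) (Cexp (RtoC 2 * x * t - t ^ 2) * r).
Proof.
  intros hH hf.
  destruct (analytic_coef_bound f a hf) as [M [rho [hrho ha]]].
  destruct (appell_series (fun n => H n (x - t)) (fun k => a k * t ^ k)
    (fun k => Cexp (RtoC 2 * (x - t) * - t - (- t) ^ 2) * H k (x - t - - t))
    _ M (rho * Cmod t) (- t) (hH (x - t))
    (Rmult_le_pos _ _ hrho (Cmod_ge_0 t))) as [r [hr hl]].
  2: { intros k. apply Hermite_shift, hH. }
  { intros k. rewrite Cmod_mult, Cmod_pow, Rpow_mult_distr.
    rewrite <- Rmult_assoc. apply Rmult_le_compat_r; [apply pow_le, Cmod_ge_0|apply ha]. }
  exists r. split.
  - refine (is_series_C_ext _ _ _ _ hr).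
    intros n. unfold appell_term, rhs_term, binomial_sum.
    replace (sum_n _ n) with ((- RtoC 1) ^ n * t ^ n *
      sum_n (fun k => RtoC (Binomial.C n k) * (- RtoC 1) ^ k * a k) n).
    { C_eq. field. apply RtoC_fact_neq_0. }
    (* The signs agree because [(-1)^n * (-1)^k = (-1)^(n-k)] for [k <= n]. *)
    rewrite <- sum_n_Cmult. apply sum_n_ext_loc. intros k hk. C_eq.
    replace n with (k + (n - k))%nat at 1 2 by lia.
    replace (- t) with (- RtoC 1 * t) by ring.
    rewrite !Cpow_add_r, Cpow_mult_l.
    transitivity ((- RtoC 1) ^ k * (- RtoC 1) ^ k *
      ((- RtoC 1) ^ (n - k) * t ^ k * t ^ (n - k) * RtoC (Binomial.C n k) * a k)).
    { ring. }
    rewrite neg_one_pow_sqr. ring.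
  - refine (is_series_C_ext _ _ _ _ (is_series_Cmult _ _ _ hl)).
    intros k. unfold lhs_term.
    replace (x - t - - t) with x by ring.
    transitivity (Cexp (RtoC 2 * x * t - t ^ 2) *
      Cexp (RtoC 2 * (x - t) * - t - (- t) ^ 2) *
      (a k * H k x * (t ^ k / RtoC (INR (fact k))))).
    { field. apply RtoC_fact_neq_0. }
    (* The exponents are opposite: the factor produced by the shift formula cancels the
       prefactor. *)
    rewrite <- Cexp_plus.
    replace (RtoC 2 * x * t - t ^ 2 + (RtoC 2 * (x - t) * - t - (- t) ^ 2))
      with (RtoC 0) by ring.
    rewrite Cexp_0. ring.
Qed.

Theorem theorem1 (H : nat -> C -> C) (hH : is_Hermite H)
    (f : C -> C) (a : nat -> C) (hf : analytic_at_0_with f a) (x : C) :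
  locally (RtoC 0) (fun t : C =>
    ex_series (lhs_term H a x t) /\ ex_series (rhs_term H a x t)) /\
  (forall t l r : C,
     is_series (lhs_term H a x t) l ->
     is_series (rhs_term H a x t) r ->
     l = Cexp (RtoC 2 * x * t - t ^ 2) * r).
Proof.
  split.
  (* Both series converge for every [t], so the whole plane serves as the neighborhood. *)
  - apply filter_forall. intros t.
    destruct (Hermite_series_transform H f a x t hH hf) as [r [hr hl]].
    split; eexists; eassumption.
  - intros t l r hl hr.
    destruct (Hermite_series_transform H f a x t hH hf) as [r' [hr' hl']].
    rewrite (is_series_C_unique _ _ _ hr hr').
    exact (is_series_C_unique _ _ _ hl hl').
Qed.
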